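(* Let $c\in(0,1)$ be a constant and $T^{-}_{c}(\alpha):=\frac{1-c}{\lambda}\log\alpha$. Then for every input $\boldsymbol{x}$, $$\lim_{\alpha\to+\infty}f\big(\boldsymbol{\theta}(T^{-}_{c}(\alpha);\alpha\bar{\boldsymbol{\theta}}_{\mathrm{init}});\boldsymbol{x}\big)=\big\langle\nabla f(\bar{\boldsymbol{\theta}}_{\mathrm{init}};\boldsymbol{x}),\boldsymbol{h}^*_{\mathrm{ntk}}\big\rangle.$$
   Context: Regression setting. Training data $\{(\boldsymbol{x}_i,y_i)\}_{i=1}^n$, $y_i\in\mathbb{R}$. Model $f(\boldsymbol{\theta};\boldsymbol{x})$, $\boldsymbol{\theta}\in\mathbb{R}^D$, with $\boldsymbol{\theta}\mapsto f(\boldsymbol{\theta};\boldsymbol{x})$ $\mathcal{C}^2$ and $L$-homogeneous ($f(c\boldsymbol{\theta};\boldsymbol{x})=c^Lf(\boldsymbol{\theta};\boldsymbol{x})$ for $c>0$) for every $\boldsymbol{x}$; $f_i(\boldsymbol{\theta}):=f(\boldsymbol{\theta};\boldsymbol{x}_i)$. Fixed $\bar{\boldsymbol{\theta}}_{\mathrm{init}}$ with $f(\bar{\boldsymbol{\theta}}_{\mathrm{init}};\boldsymbol{x})=0$ for all $\boldsymbol{x}$. Loss $\mathcal{L}(\boldsymbol{\theta})=\frac1n\sum_i(f_i(\boldsymbol{\theta})-y_i)^2$, $\mathcal{L}_\lambda=\mathcal{L}+\frac\lambda2\|\boldsymbol{\theta}\|_2^2$, with $\lambda=\lambda(\alpha)=\Theta(\alpha^{-p})$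 for a constant $p>0$. $\boldsymbol{\theta}(t;\boldsymbol{\theta}_0)$ is the gradient flow $\frac{d\boldsymbol{\theta}}{dt}=-\nabla\mathcal{L}_\lambda(\boldsymbol{\theta})$ from $\boldsymbol{\theta}_0$. Assume the vectors $\nabla f_i(\bar{\boldsymbol{\theta}}_{\mathrm{init}})$, $i\in[n]$, are linearly independent. $\boldsymbol{h}^*_{\mathrm{ntk}}$ is the solution of $\min\frac12\|\boldsymbol{h}\|_2^2$ s.t. $\langle\nabla f_i(\bar{\boldsymbol{\theta}}_{\mathrm{init}}),\boldsymbol{h}\rangle=y_i$ for all $i\in[n]$. *)

(* Defs.v *)
From HB Require Import structures.
From mathcomp Require Import all_boot all_order all_algebra.
From mathcomp Require Import all_classical all_reals all_analysis.
Set Implicit Arguments. Unset Strict Implicit. Unset Printing Implicit Defensive.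
Import Order.TTheory GRing.Theory Num.Theory.
Import numFieldNormedType.Exports.
Local Open Scope classical_set_scope.
Local Open Scope ring_scope.

Definition unitv {R : realType} {D : nat} (i : 'I_D) : 'rV[R]_D := delta_mx 0 i.

Definition dotv {R : realType} {D : nat} (u v : 'rV[R]_D) : R :=
  \sum_(i < D) u 0 i * v 0 i.
Definition sqnorm {R : realType} {D : nat} (u : 'rV[R]_D) : R := dotv u u.

Definition grad {R : realType} {D : nat} (g : 'rV[R]_D -> R) (th : 'rV[R]_D)
  : 'rV[R]_D := \row_(i < D) ('D_(unitv i) g) th.

Definition C2 {R : realType} {D : nat} (g : 'rV[R]_D -> R) : Prop :=
  continuous g /\
  forall i j : 'I_D,
    (forall th, derivable g th (unitv i)) /\
    continuous ('D_(unitv i) g) /\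
    (forall th, derivable ('D_(unitv i) g) th (unitv j)) /\
    continuous ('D_(unitv j) ('D_(unitv i) g)).

Definition loss {R : realType} {X : Type} {D n : nat} (f : 'rV[R]_D -> X -> R)
  (xs : 'I_n -> X) (ys : 'I_n -> R) (th : 'rV[R]_D) : R :=
  n%:R^-1 * \sum_(i < n) (f th (xs i) - ys i) ^+ 2.
Definition lossreg {R : realType} {X : Type} {D n : nat} (f : 'rV[R]_D -> X -> R)
  (xs : 'I_n -> X) (ys : 'I_n -> R) (lam : R) (th : 'rV[R]_D) : R :=
  loss f xs ys th + lam / 2 * sqnorm th.

Definition gradient_flow {R : realType} {D : nat} (F : 'rV[R]_D -> R)
  (th0 : 'rV[R]_D) (traj : R -> 'rV[R]_D) : Prop :=
  traj 0 = th0 /\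
  {within [set t : R | 0 <= t], continuous traj} /\
  forall t : R, 0 < t -> is_derive t 1 traj (- grad F (traj t)).

Definition Theta_neg_pow {R : realType} (lam : R -> R) (p : R) : Prop :=
  exists c1 c2 a0 : R, 0 < c1 /\ 0 < c2 /\
    forall a, a0 <= a -> c1 * a `^ (- p) <= lam a /\ lam a <= c2 * a `^ (- p).

Definition is_min_norm_interp {R : realType} {D n : nat} (g : 'I_n -> 'rV[R]_D)
  (ys : 'I_n -> R) (h : 'rV[R]_D) : Prop :=
  (forall i, dotv (g i) h = ys i) /\
  forall h', (forall i, dotv (g i) h' = ys i) -> sqnorm h / 2 <= sqnorm h' / 2.

(* Main.v *)
(* Write [s = a * expR (- lam * t)] for the norm factor left by weight decay
   alone, [phi = theta / s], [h = s ^ L (phi - thbar)] for the rescaled deviation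
   and [r_i = f_i(theta) - y_i] for the residuals.  By homogeneity and Euler's
   identity, with [J] the Jacobian at [phi] and [mu = (2/n) s ^ (2L-2)],
     h' = - lam L h - mu J^T r,    r' = - mu J J^T r - lam L (r + y).
   While [phi] is near [thbar], [J J^T >= k > 0], so for every linear form [w]
   with [|w J^T| <= b] the quantity [w(h) + (b/k) |r|] is a Lyapunov function and
   [|w(h)| <= b |y| / k].  Taking coordinate forms, [h] stays bounded, hence
   [phi - thbar = s ^ -L h] is small up to time [T], where [s >= a ^ c]: the
   assumption on [phi] propagates by continuity.  Taking [w] orthogonal to the
   gradients at [thbar], [b] is small, so [h] stays almost in their span; and
   [r(T)] tends to [0] since [mu >= 2/n] while [lam] tends to [0] and [T] to
   infinity.  Decomposing the gradient of [f(.; x)] at [thbar] along that span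
   and its complement gives the limit of [f(theta(T); x) ~ <grad f, h>].  With
   at least one data point, [L >= 1] is forced by the continuity of the gradient
   at the origin. *)
Require Import Defs.
From HB Require Import structures.
From mathcomp Require Import all_boot all_order all_algebra.
From mathcomp Require Import all_classical all_reals all_analysis.
From mathcomp Require Import ring lra.
Import Order.TTheory GRing.Theory Num.Theory.
Import numFieldNormedType.Exports.
Local Open Scope classical_set_scope.
Local Open Scope ring_scope.

Set Implicit Arguments. Unset Strict Implicit.

(** * Scalar differential inequalities *)

Lemma is_derive_le0_le (R : realType) (F dF : R -> R) (T : R) :
  0 <= T -> {within `[0, T], continuous F} ->
  (forall t : R, 0 < t < T -> is_derive t 1 F (dF t)) ->
  (forall t : R, 0 < t < T -> dF t <= 0) -> F T <= F 0.
Proof.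
move=> T0 cF dFE dF0.
apply: (@ler0_derive1_le_cc _ F 0 T) => //.
- by move=> x; rewrite in_itv/= => /dFE h; exact: ex_derive.
- by move=> x; rewrite in_itv/= derive1E => h; have := dFE x h => d;
    rewrite derive_val; exact: dF0.
- by rewrite in_itv/= T0 lexx.
- by rewrite in_itv/= T0 lexx.
Qed.

Lemma within_continuousM (R : realType) (A : set R) (f g : R -> R) :
  {within A, continuous f} -> {within A, continuous g} ->
  {within A, continuous (fun t => f t * g t)}.
Proof. by move=> cf cg t; exact: (continuousM (cf t) (cg t)). Qed.

Lemma within_continuous_cst (R : realType) (A : set R) (k : R) :
  {within A, continuous (fun=> k)}.
Proof. by apply: continuous_subspaceT => t; exact: cst_continuous. Qed.

Lemma within_continuous_expRM (R : realType) (l : R) (A : set R) :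
  {within A, continuous (fun t : R => expR (l * t))}.
Proof.
apply: continuous_subspaceT => t.
by apply: continuous_comp; [exact: mulrl_continuous | exact: continuous_expR].
Qed.

Lemma is_derive_expRM (R : realType) (l t : R) :
  is_derive t 1 (fun u : R => expR (l * u)) (l * expR (l * t)).
Proof.
have H : is_derive t 1 (fun u : R => l * u) l.
  apply: is_derive_eq; rewrite /GRing.scale/=; ring.
have := is_derive1_comp (is_derive_expR (l * t)) H.
by move=> /is_derive_eq; apply; rewrite mulrC.
Qed.

(* The integrating factor [expR (l * t)] absorbs the linear term. *)
Lemma gronwall_affine (R : realType) (q dq : R -> R) (l C T : R) :
  0 <= T -> {within `[0, T], continuous q} ->
  (forall t : R, 0 < t < T -> is_derive t 1 q (dq t)) ->
  (forall t : R, 0 < t < T -> dq t + l * q t <= l * C) ->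
  q T - C <= expR (- (l * T)) * (q 0 - C).
Proof.
move=> T0 cq dqE dq0.
pose F (t : R) : R := expR (l * t) * (q t - C).
suff : F T <= F 0.
  rewrite /F mulr0 expR0 mul1r => H.
  by rewrite expRN ler_pdivlMl ?expR_gt0.
apply: (@is_derive_le0_le R F (fun t => expR (l * t) * (dq t + l * q t - l * C))) => //.
- apply: within_continuousM; first exact: within_continuous_expRM.
  by apply: within_continuousB => //; exact: within_continuous_cst.
- move=> t tT; have d1 := is_derive_expRM l t; have d2 := dqE t tT.
  apply: is_derive_eq; rewrite /GRing.scale/=; ring.
- move=> t tT; rewrite mulr_ge0_le0 ?expR_ge0// subr_le0; exact: dq0.
Qed.

(* [q + b / k * sqrt (Z + d ^+ 2)] is a Lyapunov function; letting [d] tend to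
   [0] removes the smoothing of the square root. *)
Lemma drift_upper_bound (R : realType) (q dq Z dZ mu : R -> R) (T l k b Y m : R) :
  0 <= T -> 0 < l -> 0 < k -> 0 <= b -> 0 <= Y ->
  {within `[0, T], continuous q} -> {within `[0, T], continuous Z} ->
  (forall t : R, 0 < t < T -> is_derive t 1 q (dq t)) ->
  (forall t : R, 0 < t < T -> is_derive t 1 Z (dZ t)) ->
  (forall t : R, 0 < t < T -> 0 <= mu t <= m) ->
  (forall t : R, 0 <= Z t) ->
  (forall t : R, 0 < t < T -> dq t + l * q t <= mu t * b * Num.sqrt (Z t)) ->
  (forall t : R, 0 < t < T ->
    dZ t <= - 2 * (mu t * k + l) * Z t + 2 * l * Y * Num.sqrt (Z t)) ->
  q 0 <= 0 -> Z 0 <= Y ^+ 2 ->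
  q T <= b * Y / k.
Proof.
move=> T0 l0 k0 b0 Y0 cq cZ dqE dZE hmu Z0 hq hZ q0 ZY.
have bk0 : 0 <= b / k by rewrite divr_ge0// ltW.
(* With this [N], [(|m| * k + l) * d = l * N * d], so the smoothing error is absorbed by the
   constant [C] below. *)
pose N : R := `|m| * k / l + 1.
have N0 : 0 < N by rewrite /N ltr_wpDl// divr_ge0 ?mulr_ge0// ltW.
have key (d : R) : 0 < d -> q T <= b / k * (Y + N * d).
  move=> d0; set C := b / k * (Y + N * d).
  pose S (t : R) : R := Num.sqrt (Z t + d ^+ 2).
  have Zd0 t : 0 < Z t + d ^+ 2 by rewrite ltr_wpDl// exprn_gt0.
  have S0 t : 0 < S t by rewrite sqrtr_gt0.
  have SS t : S t ^+ 2 = Z t + d ^+ 2 by rewrite sqr_sqrtr// ltW.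
  have dS t : d <= S t.
    rewrite -(@ler_pXn2r _ 2)// ?nnegrE ?(ltW d0) ?(ltW (S0 t))// SS.
    by rewrite lerDr.
  have zS t : Num.sqrt (Z t) <= S t by rewrite ler_sqrt ?lerDl ?sqr_ge0// ltW.
  have := @gronwall_affine R (fun t => q t + b / k * S t)
     (fun t => dq t + b / k * (dZ t / (2 * S t))) l C T T0.
  have -> : q T <= C = (q T - C <= 0) by rewrite subr_le0.
  move=> H.
  apply: (@le_trans _ _ (q T + b / k * S T - C)).
    by rewrite lerD2r lerDl mulr_ge0// ltW.
  apply: le_trans (H _ _ _) _.
  - apply: within_continuousD => //; apply: within_continuousM; first exact: within_continuous_cst.
    apply: (@within_continuous_comp _ _ _ `[0, T] (fun t => Z t + d ^+ 2) Num.sqrt).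
      by move=> x _; exact: sqrt_continuous.
    by apply: within_continuousD => //; exact: within_continuous_cst.
  - move=> t tT; have d1 := dqE t tT; have d2 := dZE t tT.
    have d3 : is_derive t 1 (fun u => Z u + d ^+ 2) (dZ t).
      by apply: is_derive_eq; rewrite addr0.
    have d4 : is_derive t 1 S ((2 * S t)^-1 * dZ t).
      have d5 := is_derive1_sqrt (Zd0 t).
      exact: (@is_derive1_comp _ Num.sqrt (fun u => Z u + d ^+ 2)).
    apply: is_derive_eq; rewrite /GRing.scale/=; ring.
  - move=> t tT; have /andP[mu0 mum] := hmu t tT.
    have {}mum : mu t <= `|m| by rewrite (le_trans mum)// ler_norm.
    (* Here [Z = S ^+ 2 - d ^+ 2], and [d <= S] bounds the correction [d ^+ 2 / S] by [d]. *)
    have A1 : dZ t / (2 * S t) <= - (mu t * k + l) * S t + (`|m| * k + l) * d + l * Y.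
      rewrite ler_pdivrMr ?mulr_gt0//.
      apply: le_trans (hZ t tT) _.
      have -> : Z t = S t ^+ 2 - d ^+ 2 by rewrite SS addrK.
      have E1 : 0 <= (mu t * k + l) by rewrite addr_ge0 ?mulr_ge0// ltW.
      have E2 : mu t * k + l <= `|m| * k + l by rewrite lerD2r ler_pM2r.
      have E3 : (mu t * k + l) * d * d <= (`|m| * k + l) * d * S t.
        by apply: ler_pM => //; [rewrite mulr_ge0// ltW|rewrite ltW|rewrite ler_pM2r].
      have E4 : l * Y * Num.sqrt (S t ^+ 2 - d ^+ 2) <= l * Y * S t.
        by rewrite ler_wpM2l ?mulr_ge0 ?(ltW l0)// SS addrK.
      have -> : - 2 * (mu t * k + l) * (S t ^+ 2 - d ^+ 2) =
         - 2 * (mu t * k + l) * S t ^+ 2 + 2 * ((mu t * k + l) * d * d) by ring.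
      have -> : (- (mu t * k + l) * S t + (`|m| * k + l) * d + l * Y) * (2 * S t) =
       - 2 * (mu t * k + l) * S t ^+ 2 + 2 * ((`|m| * k + l) * d * S t) + 2 * (l * Y * S t) by ring.
      lra.
    have A2 : mu t * b * Num.sqrt (Z t) <= mu t * b * S t by rewrite ler_wpM2l// mulr_ge0.
    have A3 := hq t tT.
    have A4 := ler_wpM2l bk0 A1.
    have A5 : b / k * (- (mu t * k + l) * S t + (`|m| * k + l) * d + l * Y) =
      - (mu t * b * S t) - l * (b / k * S t) + l * C.
      rewrite /C /N; field; rewrite ?(gt_eqF k0) ?(gt_eqF l0)//.
    lra.
  rewrite mulr_ge0_le0 ?expR_ge0// subr_le0.
  have S0d : S 0 <= Y + d.
    rewrite -(@ler_pXn2r _ 2)// ?nnegrE ?addr_ge0 ?(ltW d0) ?(ltW (S0 0))// SS.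
    have : 0 <= Y * d by rewrite mulr_ge0// ltW.
    nra.
  have : b / k * S 0 <= C.
    rewrite /C ler_wpM2l//; apply: (@le_trans _ _ (Y + d)) => //.
    rewrite lerD2l ler_peMl ?(ltW d0)// /N lerDr divr_ge0 ?mulr_ge0// ltW//.
  lra.
apply/ler_addgt0Pr => e e0.
(* [d] will be chosen so that the smoothing error [b / k * N * d] equals [e]; this requires [b] to
   be nonzero. *)
have [bz|bz] := eqVneq b 0.
  have := key 1 ltr01; rewrite bz !mul0r; lra.
have b1 : 0 < b by rewrite lt0r bz.
have bk : 0 < b / k by rewrite divr_gt0.
have d0 : 0 < e / (b / k * N) by apply: divr_gt0 => //; exact: mulr_gt0.
apply: le_trans (key _ d0) _.
have -> : b / k * (Y + N * (e / (b / k * N))) = b * Y / k + e; last by [].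
field; rewrite ?(gt_eqF k0) ?(gt_eqF N0) ?bz//.
Qed.

Lemma drift_bound (R : realType) (q dq Z dZ mu : R -> R) (T l k b Y m : R) :
  0 <= T -> 0 < l -> 0 < k -> 0 <= b -> 0 <= Y ->
  {within `[0, T], continuous q} -> {within `[0, T], continuous Z} ->
  (forall t : R, 0 < t < T -> is_derive t 1 q (dq t)) ->
  (forall t : R, 0 < t < T -> is_derive t 1 Z (dZ t)) ->
  (forall t : R, 0 < t < T -> 0 <= mu t <= m) ->
  (forall t : R, 0 <= Z t) ->
  (forall t : R, 0 < t < T -> `|dq t + l * q t| <= mu t * b * Num.sqrt (Z t)) ->
  (forall t : R, 0 < t < T ->
    dZ t <= - 2 * (mu t * k + l) * Z t + 2 * l * Y * Num.sqrt (Z t)) ->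
  q 0 = 0 -> Z 0 <= Y ^+ 2 ->
  `|q T| <= b * Y / k.
Proof.
move=> T0 l0 k0 b0 Y0 cq cZ dqE dZE hmu Z0 hq hZ q0 ZY.
have H := fun q dq => @drift_upper_bound R q dq Z dZ mu T l k b Y m T0 l0 k0 b0 Y0.
rewrite ler_norml; apply/andP; split; last first.
  apply: (H q dq) => //; last by rewrite q0.
  by move=> t tT; rewrite (le_trans _ (hq t tT))// ler_norm.
rewrite lerNl; apply: (H (fun t => - q t) (fun t => - dq t)) => //.
- by move=> t; exact: (continuousN (cq t)).
- by move=> t tT; have d1 := dqE t tT; apply: is_derive_eq.
- move=> t tT; rewrite (le_trans _ (hq t tT))// -normrN.
  by apply: le_trans (ler_norm _); rewrite mulrN opprD.
- by rewrite q0 oppr0.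
Qed.

(** With [z = Num.sqrt Z], completing the square gives [2 * l * Y * z <= l * Y ^+ 2 / 2 + 2 * l * z
    ^+ 2]. The damping [l] cancels the quadratic term, which leaves
    [dZ + nu * Z <= l * Y ^+ 2 / 2]. *)
Lemma residual_decay (R : realType) (Z dZ mu : R -> R) (T l k Y nu : R) :
  0 <= T -> 0 < l -> 0 < nu -> 0 <= k ->
  {within `[0, T], continuous Z} ->
  (forall t : R, 0 < t < T -> is_derive t 1 Z (dZ t)) ->
  (forall t : R, 0 < t < T -> nu <= 2 * mu t * k) ->
  (forall t : R, 0 <= Z t) ->
  (forall t : R, 0 < t < T ->
    dZ t <= - 2 * (mu t * k + l) * Z t + 2 * l * Y * Num.sqrt (Z t)) ->
  Z 0 <= Y ^+ 2 ->
  Z T <= l * Y ^+ 2 / (2 * nu) + expR (- (nu * T)) * Y ^+ 2.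
Proof.
move=> T0 l0 nu0 k0 cZ dZE hmu Z0 hZ ZY.
set C := l * Y ^+ 2 / (2 * nu).
have C0 : 0 <= C.
  by apply: divr_ge0; apply: mulr_ge0; rewrite ?sqr_ge0 ?(ltW l0) ?(ltW nu0).
have := @gronwall_affine R Z dZ nu C T T0 cZ dZE.
rewrite lerBlDl => H; apply: le_trans (H _) _.
  move=> t tT; apply: le_trans (lerD (hZ t tT) (lexx _)) _.
  set z := Num.sqrt (Z t).
  have Ez : Z t = z ^+ 2 by rewrite sqr_sqrtr.
  have E1 : nu * Z t <= 2 * mu t * k * Z t by rewrite ler_wpM2r// hmu.
  have -> : nu * C = l * (Y ^+ 2 / 2) by rewrite /C; field; rewrite gt_eqF.
  have : 0 <= l * ((Y - 2 * z) ^+ 2 / 2) by rewrite mulr_ge0 ?divr_ge0 ?sqr_ge0// ltW.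
  have -> : l * ((Y - 2 * z) ^+ 2 / 2) = l * (Y ^+ 2 / 2) - 2 * l * Y * z + 2 * l * Z t.
    by rewrite Ez; field.
  nra.
rewrite lerD2l ler_wpM2l ?expR_ge0//; lra.
Qed.

(** At the infimum of the times where [M <= N], all earlier values are below [M], so the second
    hypothesis puts this value strictly below [M]. Continuity extends this to nearby times, against
    the definition of the infimum. At time [0] the inner premise is vacuous, which supplies the base
    case. *)
Lemma continuity_bootstrap (R : realType) (N : R -> R) (T M : R) :
  {within `[0, T], continuous N} ->
  (forall t : R, 0 <= t <= T ->
    (forall u : R, 0 <= u < t -> N u < M) -> N t < M) ->
  forall t : R, 0 <= t <= T -> N t < M.
Proof.
move=> /subspace_continuousP cN step t tT; rewrite ltNge; apply/negP => Mt.
pose S : set R := [set u | 0 <= u <= T /\ M <= N u].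
have S0 : S !=set0 by exists t.
have lbS : has_lbound S by exists 0 => u [/andP[]].
have iS : has_inf S by split.
have i0 : 0 <= inf S by apply: lb_le_inf => // u [/andP[]].
have it : inf S <= t by apply: ge_inf.
have iT : 0 <= inf S <= T by rewrite i0 (le_trans it)//; case/andP: tT.
have NM : N (inf S) < M.
  apply: step => // u /andP[u0 ui]; rewrite ltNge; apply/negP => Mu.
  suff : inf S <= u by rewrite leNgt ui.
  apply: ge_inf => //; split => //; rewrite u0 (le_trans (ltW ui))//.
  by case/andP: iT.
have /cN : `[0, T]%classic (inf S) by rewrite /= in_itv.
move=> /cvgrPdist_lt /(_ (M - N (inf S))); rewrite subr_gt0 => /(_ NM).
move=> [/= e e0 He].
have [u [uT Mu] ue] := inf_adherent e0 iS.
have iu : inf S <= u by apply: ge_inf.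
have := He u; rewrite /= in_itv/= uT distrC ger0_norm ?subr_ge0//.
rewrite ltrBlDl => /(_ ue isT); rewrite ltr_distlC => /andP[_].
by rewrite addrCA subrr addr0 ltNge Mu.
Qed.

(** * The inner product [dotv] and the sup norm of row vectors *)

Section dotv_theory.
Context {R : realType} {D : nat}.
Implicit Types u v w : 'rV[R]_D.

Lemma coord_le_norm v j : `|v 0 j| <= `|v|.
Proof.
rewrite [leRHS]/Num.Def.normr/= mx_normrE.
exact: (le_bigmax _ (fun ij => `|v ij.1 ij.2|) (0, j)).
Qed.

Lemma norm_le_coord v (M : R) : 0 <= M -> (forall j, `|v 0 j| <= M) -> `|v| <= M.
Proof.
move=> M0 H; rewrite [leLHS]/Num.Def.normr/= mx_normrE.
by apply: bigmax_le => // -[i j] _ /=; rewrite ord1.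
Qed.

Lemma dotvC u v : dotv u v = dotv v u.
Proof. by apply: eq_bigr => i _; rewrite mulrC. Qed.

Lemma dotv_linear u (a : R) v w : dotv u (a *: v + w) = a * dotv u v + dotv u w.
Proof.
rewrite /dotv mulr_sumr -big_split; apply: eq_bigr => i _ /=.
by rewrite !mxE mulrDr mulrCA.
Qed.

Lemma dotv_is_linear u : linear (dotv u : 'rV[R]_D -> R).
Proof. by move=> a v w; exact: dotv_linear. Qed.
HB.instance Definition _ u :=
  GRing.isLinear.Build R 'rV[R]_D R _ (dotv u) (dotv_is_linear u).

Lemma normr_dotv_le u v : `|dotv u v| <= D%:R * `|u| * `|v|.
Proof.
apply: le_trans (ler_norm_sum _ _ _) _.
apply: (@le_trans _ _ (\sum_(i < D) `|u| * `|v|)).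
  by apply: ler_sum => i _; rewrite normrM ler_pM// coord_le_norm.
by rewrite sumr_const card_ord -mulrA mulr_natl.
Qed.

Lemma dotv_unitv u j : dotv u (unitv j) = u 0 j.
Proof.
rewrite /dotv (bigD1 j)//= big1 ?addr0 => [|i ij]; rewrite !mxE !eqxx ?mulr1//.
by rewrite (negbTE ij) mulr0.
Qed.

Lemma continuous_dotv u : continuous (dotv u).
Proof.
apply/linear_bounded_continuous/linear_boundedP.
exists (D%:R * `|u|); split; first exact: num_real.
by move=> r ur v; rewrite (le_trans (normr_dotv_le u v))// ler_wpM2r// ltW.
Qed.

End dotv_theory.

(** * Functions with continuous partial derivatives *)

Definition C1 {R : realType} {D : nat} (g : 'rV[R]_D -> R) : Prop :=
  (forall i th, derivable g th (unitv i)) /\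
  (forall i, continuous ('D_(unitv i) g)).

Lemma C2_C1 (R : realType) (D : nat) (g : 'rV[R]_D -> R) : C2 g -> C1 g.
Proof. by move=> [_ h]; split=> i; have [? []] := h i i. Qed.

Lemma is_derive_line (R : realType) (V : normedModType R) (g : V -> R) (w u : V)
    (h0 : R) :
  derivable g (w + h0 *: u) u ->
  is_derive h0 1 (fun h : R => g (w + h *: u)) ('D_u g (w + h0 *: u)).
Proof.
move=> dg.
have E : (fun h : R => h^-1 *: (g (w + (h *: 1 + h0) *: u) - g (w + h0 *: u)))
       = (fun h : R => h^-1 *: (g (h *: u + (w + h0 *: u)) - g (w + h0 *: u))).
  apply/funext => h; congr (_ *: (g _ - _)).
  by rewrite scalerDl addrCA; congr (_ *: u + _); rewrite /GRing.scale/= mulr1.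
by split; rewrite /derivable /derive/= E.
Qed.

Lemma line_mean_value_estimate (R : realType) (V : normedModType R) (g : V -> R)
    (w u : V) (c G e : R) :
  (forall th, derivable g th u) ->
  (forall h : R, `|h| <= `|c| -> `|'D_u g (w + h *: u) - G| <= e) ->
  `|g (w + c *: u) - g w - c * G| <= e * `|c|.
Proof.
move=> dg He.
pose p (h : R) := g (w + h *: u).
have dp (h : R) : is_derive h 1 p ('D_u g (w + h *: u)) by apply: is_derive_line.
have cp (A : set R) : {within A, continuous p}.
  apply: continuous_subspaceT => h; apply: differentiable_continuous.
  by apply/derivable1_diffP; have := dp h => ?.
have [h hc E] : exists2 h : R, `|h| <= `|c| &
    g (w + c *: u) - g w = 'D_u g (w + h *: u) * c.
  have p0 : p 0 = g w by rewrite /p scale0r addr0.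
  have [c0|c0] := leP 0 c.
    have [h] := MVT_segment c0 (fun h _ => dp h) (cp _).
    rewrite p0 subr0 in_itv/= => /andP[h0 hc] E; exists h => //.
    by rewrite !ger0_norm.
  have [h] := MVT_segment (ltW c0) (fun h _ => dp h) (cp _).
  rewrite p0 sub0r in_itv/= => /andP[h0 hc] E; exists h => //.
    by rewrite !ler0_norm ?lerN2// ltW.
  by apply: oppr_inj; rewrite opprB E mulrN.
rewrite E mulrC -mulrBr normrM mulrC ler_wpM2r//.
exact: He.
Qed.

(* Change the coordinates of [th] into those of [v] one at a time and apply the
   mean value theorem to each step. *)
Lemma C1_expansion (R : realType) (D : nat) (g : 'rV[R]_D -> R) (th : 'rV[R]_D)
    (e : R) :
  C1 g -> 0 < e ->
  \forall v \near th, `|g v - g th - dotv (grad g th) (v - th)| <= e * `|v - th|.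
Proof.
move=> [dg cg] e0.
(* Each of the [D] coordinate steps may cost [e'] times the norm; [D.+1] keeps the quotient
   meaningful in dimension [0]. *)
pose e' := e / D.+1%:R.
have e'0 : 0 < e' by rewrite divr_gt0.
have [d d0 Hd] : exists2 d : R, 0 < d & forall v, `|v - th| < d ->
    forall i, `|'D_(unitv i) g v - 'D_(unitv i) g th| <= e'.
  have : \forall v \near th, forall i, `|'D_(unitv i) g v - 'D_(unitv i) g th| <= e'.
    apply: (@filter_forall _ 'I_D
      (fun i v => `|'D_(unitv i) g v - 'D_(unitv i) g th| <= e')
      _ (nbhs_filter th)) => i.
    by have /cvgrPdist_le/(_ e' e'0) := cg i th; apply: filterS => v; rewrite distrC.
  move=> /nbhs_ballP[d /= d0 Hd]; exists d => // v vd i; apply: Hd.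
  by rewrite -ball_normE /ball_/= distrC.
apply/nbhs_ballP; exists d => //= v; rewrite -ball_normE /ball_/= distrC => vd.
pose w (k : nat) : 'rV[R]_D := \row_j (if (j < k)%N then v 0 j else th 0 j).
have w0 : w 0%N = th by apply/rowP => j; rewrite mxE.
have wD : w D = v by apply/rowP => j; rewrite mxE ltn_ord.
have wS (k : 'I_D) : w k.+1 = w k + (v 0 k - th 0 k) *: unitv k.
  apply/rowP => j; rewrite !mxE eqxx/= ltnS leq_eqVlt.
  have [->|jk] := eqVneq j k; first by rewrite eqxx ltnn/= mulr1 addrCA subrr addr0.
  by rewrite (inj_eq val_inj) (negbTE jk)/= mulr0 addr0.
have -> : g v - g th = \sum_(k < D) (g (w k.+1) - g (w k)).
  rewrite -(big_mkord xpredT (fun k => g (w k.+1) - g (w k))) telescope_sumr//.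
  by rewrite wD w0.
rewrite /dotv -sumrB.
apply: le_trans (ler_norm_sum _ _ _) _.
apply: (@le_trans _ _ (\sum_(k < D) e' * `|v - th|)); last first.
  rewrite sumr_const card_ord -mulr_natl mulrA ler_wpM2r//.
  rewrite /e' mulrCA ler_piMr ?(ltW e0)// ler_pdivrMr// mul1r ler_nat.
  exact: leqnSn.
apply: ler_sum => k _.
have vk : `|v 0 k - th 0 k| <= `|v - th|.
  by have := coord_le_norm (v - th) k; rewrite !mxE.
rewrite wS !mxE mulrC.
apply: le_trans (line_mean_value_estimate (e := e') _ _) _ => //.
  (* On this segment every coordinate of the displacement from [th] is [h], that of [v - th], or
     [0], so the sup norm never exceeds that of [v - th]. *)
  move=> h hk; apply: Hd; apply: le_lt_trans vd.
  apply: norm_le_coord => // j; rewrite !mxE eqxx/=.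
  have [->|jk] := eqVneq j k.
    by rewrite ltnn mulr1 addrAC subrr add0r (le_trans hk).
  rewrite mulr0 addr0; case: ifP => _; last by rewrite subrr normr0.
  by have := coord_le_norm (v - th) j; rewrite !mxE.
by rewrite ler_wpM2l// ltW.
Qed.

(** [C1_expansion] is the little-o expansion with linear part [dotv (grad g th)]; uniqueness of the
    differential then identifies it. *)
Lemma C1_differentiable (R : realType) (D : nat) (g : 'rV[R]_D -> R) th :
  C1 g -> differentiable g th /\ 'd g th = dotv (grad g th) :> ('rV[R]_D -> R).
Proof.
move=> C1g.
have H : g \o shift th = cst (g th) + (dotv (grad g th)) +o_ 0 id.
  apply/eqaddoP => e e0.
  have := C1_expansion th C1g e0.
  rewrite (near_shift 0) subr0; apply: filterS => v /=.
  by rewrite addrK !fctE/= opprD addrA.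
have E := diff_unique (@continuous_dotv _ _ (grad g th)) H.
split=> //; apply/diff_locallyP; rewrite E; split => //.
exact: continuous_dotv.
Qed.

Lemma derive_gradE (R : realType) (D : nat) (g : 'rV[R]_D -> R) th v :
  C1 g -> 'D_v g th = dotv (grad g th) v.
Proof. by move=> /(C1_differentiable th) [dg E]; rewrite deriveE// E. Qed.

Lemma is_derive_comp_grad (R : realType) (D : nat) (g : 'rV[R]_D -> R)
    (x : R -> 'rV[R]_D) (dx : 'rV[R]_D) (t : R) :
  C1 g -> is_derive t 1 x dx ->
  is_derive t 1 (fun u => g (x u)) (dotv (grad g (x t)) dx).
Proof.
move=> /(C1_differentiable (x t)) [dg E] dxt.
have dx1 : differentiable x t by apply/derivable1_diffP.
split.
  exact/diff_derivable/(differentiable_comp dx1).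
rewrite deriveE; last exact: differentiable_comp.
by rewrite diff_comp//= E -deriveE// derive_val.
Qed.

(** * Homogeneous functions *)

Section homogeneous.
Context {R : realType} {D : nat}.
Variables (g : 'rV[R]_D -> R) (L : R).
Hypothesis C1g : C1 g.
Hypothesis homg : forall (s : R) th, g (expR s *: th) = expR (L * s) * g th.

(** Differentiate [g (expR s *: th)] at [s = 0] in two ways, by the chain rule and through
    [homg]. *)
Lemma euler_homogeneous th : dotv (grad g th) th = L * g th.
Proof.
have dx : is_derive (0 : R) 1 (fun s : R => expR s *: th) th.
  have d1 := is_derive_expR (0 : R).
  have d2 : is_derive (0 : R) 1 (fun s : R => expR s *: th) (expR 0 *: th).
    have dd : differentiable (expR : R -> R) 0 by apply/derivable1_diffP.
    split; first exact/diff_derivable/differentiableZl.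
    rewrite deriveE; last exact: differentiableZl.
    by rewrite diffZl//= -deriveE// derive_val.
  by move: d2; rewrite expR0 scale1r.
have := is_derive_comp_grad C1g dx.
under eq_fun do rewrite homg.
rewrite expR0 scale1r => -[_ <-].
have d3 := is_derive_expRM L 0.
have : is_derive (0 : R) 1 (fun u : R => expR (L * u) * g th) (L * g th).
  by apply: is_derive_eq; rewrite /GRing.scale/= !mulr0 expR0; ring.
by move=> ?; rewrite derive_val.
Qed.

(** Differentiate [g (expR s *: (th + h *: unitv j))] in [h] at [0] in two ways. The direction
    [expR s *: unitv j] contributes the factor [expR s] by which the degree drops to [L - 1]. *)
Lemma grad_homogeneous (s : R) th :
  grad g (expR s *: th) = expR ((L - 1) * s) *: grad g th.
Proof.
apply/rowP => j; rewrite !mxE.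
have d1 : is_derive (0 : R) 1 (fun h : R => g (th + h *: unitv j)) ('D_(unitv j) g th).
  have := @is_derive_line _ _ g th (unitv j) 0; rewrite scale0r addr0; apply.
  exact: (C1g.1).
have d2 : is_derive (0 : R) 1 (fun h : R => g (expR s *: th + h *: (expR s *: unitv j)))
    ('D_(expR s *: unitv j) g (expR s *: th)).
  have := @is_derive_line _ _ g (expR s *: th) (expR s *: unitv j) 0.
  rewrite scale0r addr0; apply.
  by apply/diff_derivable; have [] := C1_differentiable (expR s *: th) C1g.
have E : (fun h : R => g (expR s *: th + h *: (expR s *: unitv j))) =
         (fun h : R => expR (L * s) * g (th + h *: unitv j)).
  apply/funext => h; rewrite -homg; congr g.
  by rewrite scalerDr !scalerA mulrC.
have d3 : is_derive (0 : R) 1 (fun h : R => expR (L * s) * g (th + h *: unitv j))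
   (expR (L * s) * 'D_(unitv j) g th).
  by apply: is_derive_eq; rewrite /GRing.scale/=; ring.
have := derive_val (is_derive := d2); rewrite E (derive_val (is_derive := d3)).
rewrite [RHS]derive_gradE// linearZ/= dotv_unitv !mxE.
rewrite /GRing.scale/= => H.
apply: (mulfI (lt0r_neq0 (expR_gt0 s))); rewrite -H mulrA -expRD.
by congr (expR _ * _); ring.
Qed.

(* The gradient has degree [L - 1] and stays bounded near the origin. *)
Lemma homogeneous_degree_ge1 th : grad g th != 0 -> 1 <= L.
Proof.
move=> gn0; rewrite leNgt; apply/negP => L1.
have [j cj] : exists j, grad g th 0 j != 0.
  apply/existsP; apply: contraNT gn0; rewrite negb_exists => /forallP H.
  by apply/eqP/rowP => j; rewrite [RHS]mxE; apply/eqP; have := H j; rewrite negbK.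
have /cvgrPdist_le/(_ 1 ltr01)/nbhs_ballP[/= d d0 Hd] := C1g.2 j 0.
set c := `|grad g th 0 j|; have c0 : 0 < c by rewrite normr_gt0.
pose B := 1 + `|'D_(unitv j) g 0|.
have B0 : 0 < B by rewrite ltr_pwDl.
have L10 : 0 < 1 - L by rewrite subr_gt0.
(* The first summand brings [expR (- k) *: th] within [d] of the origin; the second makes the lower
   bound [(1 + (1 - L) * k) * c] on the partial derivative exceed [B]. *)
pose k := `|th| / d + B / ((1 - L) * c).
have A1 : 0 <= `|th| / d by rewrite divr_ge0// ltW.
have A2 : 0 < B / ((1 - L) * c) by rewrite divr_gt0// mulr_gt0.
have k0 : 0 < k by rewrite ltr_wpDl.
have : `|'D_(unitv j) g (expR (- k) *: th)| <= B.
  have := Hd (expR (- k) *: th); rewrite -ball_normE /ball_/= sub0r normrN normrZ.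
  rewrite ger0_norm ?expR_ge0// expRN mulrC ltr_pdivrMr ?expR_gt0// => H.
  have thk : `|th| < d * expR k.
    apply: lt_le_trans (_ : d * (1 + k) <= _); last first.
      by rewrite ler_pM2l// expR_ge1Dx.
    rewrite mulrDr mulr1 /k mulrDr mulrCA divff ?gt_eqF// mulr1.
    have : 0 < d * (B / ((1 - L) * c)) by rewrite mulr_gt0.
    lra.
  have := H thk; rewrite distrC => /(le_trans (lerB_dist _ _)).
  by rewrite /B lerBlDr.
have -> : 'D_(unitv j) g (expR (- k) *: th) = grad g (expR (- k) *: th) 0 j by rewrite mxE.
rewrite grad_homogeneous mxE normrM -/c ger0_norm ?expR_ge0// => H.
have H1 : 1 + (1 - L) * k <= expR ((L - 1) * - k).
  by have := expR_ge1Dx ((1 - L) * k); congr (_ <= expR _); ring.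
have := le_trans (ler_wpM2r (ltW c0) H1) H.
have -> : (1 + (1 - L) * k) * c = c + (1 - L) * (`|th| / d) * c + B.
  by rewrite /k; field; rewrite !gt_eqF.
move=> H2.
have : 0 <= (1 - L) * (`|th| / d) * c.
  by apply: mulr_ge0; rewrite ?(ltW c0)// mulr_ge0// ltW.
lra.
Qed.

End homogeneous.

(** * The gradient of the regularized loss *)

Lemma is_derive_dotv (R : realType) (D : nat) (w th u : 'rV[R]_D) :
  is_derive th u (dotv w) (dotv w u).
Proof.
have cw := @continuous_dotv _ _ w.
have dw : differentiable (dotv w) th by exact: linear_differentiable.
by split; [exact: diff_derivable | rewrite deriveE// diff_lin].
Qed.

Lemma is_derive_sumf (R : realType) (V : normedModType R) (n : nat)
    (F : 'I_n -> V -> R) (dF : 'I_n -> R) (x v : V) :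
  (forall i, is_derive x v (F i) (dF i)) ->
  is_derive x v (fun y => \sum_(i < n) F i y) (\sum_(i < n) dF i).
Proof.
move=> H; have := @is_derive_sum _ _ _ n F x v dF H.
by have -> : \sum_(i < n) F i = (fun y => \sum_(i < n) F i y)
  by apply/funext => y; rewrite fct_sumE.
Qed.

Lemma grad_lossreg (R : realType) (X : Type) (D n : nat) (f : 'rV[R]_D -> X -> R)
    (xs : 'I_n -> X) (ys : 'I_n -> R) (lam : R) (th : 'rV[R]_D) :
  (forall x, C1 (fun th => f th x)) ->
  grad (lossreg f xs ys lam) th =
  (2 / n%:R) *: \sum_(i < n) (f th (xs i) - ys i) *: grad (fun th => f th (xs i)) th
  + lam *: th.
Proof.
move=> C1f; apply/rowP => j; rewrite !mxE summxE.
have d1 (i : 'I_n) : is_derive th (unitv j) (fun th => (f th (xs i) - ys i) ^+ 2)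
    (2 * ((f th (xs i) - ys i) * 'D_(unitv j) (fun th => f th (xs i)) th)).
  have d2 := derivableP ((C1f (xs i)).1 j th).
  by apply: is_derive_eq; rewrite /GRing.scale/= ; ring.
have d3 := is_derive_sumf d1.
have d4 (i : 'I_D) : is_derive th (unitv j) (fun th : 'rV[R]_D => th 0 i * th 0 i)
    (2 * (th 0 i * (unitv j : 'rV[R]_D) 0 i)).
  have := is_derive_dotv (unitv i) th (unitv j).
  have -> : dotv (unitv i) = (fun th : 'rV[R]_D => th 0 i).
    by apply/funext => v; rewrite dotvC dotv_unitv.
  by move=> /= d5; apply: is_derive_eq; rewrite /GRing.scale/=; ring.
have d6 := is_derive_sumf d4.
have : is_derive th (unitv j) (lossreg f xs ys lam)
   (n%:R^-1 * (\sum_(i < n) (2 * ((f th (xs i) - ys i) * 'D_(unitv j) (fun th => f th (xs i)) th)))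
     + lam / 2 * \sum_(i < D) 2 * (th 0 i * (unitv j : 'rV[R]_D) 0 i)).
  rewrite /lossreg /loss /sqnorm /dotv.
  by apply: is_derive_eq; rewrite /GRing.scale/=; ring.
move=> dd; rewrite derive_val -!mulr_sumr.
have -> : \sum_(i < D) th 0 i * (unitv j : 'rV[R]_D) 0 i = th 0 j by exact: dotv_unitv.
congr (_ + _); last by field.
rewrite mulrCA mulrA; congr (_ * _); apply: eq_bigr => i _; by rewrite !mxE.
Qed.

(** * The rescaled gradient flow *)

Lemma is_derive_dotv_comp (R : realType) (D : nat) (w : 'rV[R]_D)
    (x : R -> 'rV[R]_D) (dx : 'rV[R]_D) (t : R) :
  is_derive t 1 x dx -> is_derive t 1 (fun u => dotv w (x u)) (dotv w dx).
Proof.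
move=> dxt.
have dx1 : differentiable x t by apply/derivable1_diffP.
have cw := @continuous_dotv _ _ w.
have dw : differentiable (dotv w) (x t) by exact: linear_differentiable.
split; first exact/diff_derivable/(differentiable_comp dx1).
rewrite deriveE; last exact: differentiable_comp.
by rewrite diff_comp//= diff_lin// -deriveE// derive_val.
Qed.

Lemma is_derive_expR_affine (R : realType) (b A lam t : R) :
  is_derive t 1 (fun u : R => expR (b * (A - lam * u)))
    (- (b * lam) * expR (b * (A - lam * t))).
Proof.
have E : (fun u : R => expR (b * (A - lam * u))) =
         (fun u : R => expR (b * A) * expR (- (b * lam) * u)).
  by apply/funext => u; rewrite -expRD; congr expR; ring.
have d1 := is_derive_expRM (- (b * lam)) t.
rewrite E; apply: is_derive_eq; rewrite /GRing.scale/=.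
rewrite (_ : b * (A - lam * t) = b * A + - (b * lam) * t); last by ring.
by rewrite expRD; ring.
Qed.

Lemma dotvZr (R : realType) (D : nat) (a : R) (u v : 'rV[R]_D) :
  dotv u (a *: v) = a * dotv u v.
Proof. by rewrite linearZ. Qed.

Lemma dotvZl (R : realType) (D : nat) (a : R) (u v : 'rV[R]_D) :
  dotv (a *: u) v = a * dotv u v.
Proof. by rewrite dotvC dotvZr dotvC. Qed.

Lemma dotv_suml (R : realType) (D n : nat) (F : 'I_n -> 'rV[R]_D) w :
  dotv (\sum_(i < n) F i) w = \sum_(i < n) dotv (F i) w.
Proof.
by rewrite dotvC raddf_sum; apply: eq_bigr => i _; rewrite /= dotvC.
Qed.

(** A crude form of Cauchy-Schwarz: every [r i] is at most the Euclidean norm of [r] in absolute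
    value. *)
Lemma sum_normM_le (R : realType) (n : nat) (r p : 'I_n -> R) :
  `|\sum_(i < n) r i * p i| <= Num.sqrt (\sum_(i < n) r i ^+ 2) * \sum_(i < n) `|p i|.
Proof.
apply: le_trans (ler_norm_sum _ _ _) _.
rewrite mulr_sumr; apply: ler_sum => i _; rewrite normrM ler_wpM2r//.
rewrite -sqrtr_sqr ler_sqrt ?sumr_ge0// => [|j _]; last exact: sqr_ge0.
by rewrite (bigD1 i)//= lerDl sumr_ge0// => j _; exact: sqr_ge0.
Qed.

Lemma sum_sqr_le (R : realType) (n : nat) (y : 'I_n -> R) :
  \sum_(i < n) y i ^+ 2 <= (\sum_(i < n) `|y i|) ^+ 2.
Proof.
rewrite expr2 mulr_suml; apply: ler_sum => i _.
rewrite -real_normK ?num_real// expr2 ler_wpM2l//.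
by rewrite (bigD1 i)//= lerDl sumr_ge0.
Qed.

Section flow.
Context {R : realType} {D n : nat}.
Variables (f : 'I_n -> 'rV[R]_D -> R) (y : 'I_n -> R) (L A lam : R).
Variables (x : R -> 'rV[R]_D) (thbar : 'rV[R]_D).
Hypothesis C1f : forall i, C1 (f i).
Hypothesis homf : forall i (s : R) th, f i (expR s *: th) = expR (L * s) * f i th.
Hypothesis f0 : forall i, f i thbar = 0.
Hypothesis n0 : (0 < n)%N.
Hypothesis L1 : 1 <= L.
Hypothesis lam0 : 0 < lam.
Hypothesis x0 : x 0 = expR A *: thbar.
Hypothesis cx : {within [set t : R | 0 <= t], continuous x}.
Hypothesis dx : forall t : R, 0 < t -> is_derive t 1 x
  (- ((2 / n%:R) *: \sum_(i < n) (f i (x t) - y i) *: grad (f i) (x t) + lam *: x t)).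

(* In the notation of the header, [expR (lsc t)] is [s], [rsc] is [phi], [dev] is
   [h], [res] is [r], [res2] is [|r|^2] and [rate] is [mu]. *)
Definition lsc (t : R) : R := A - lam * t.
Definition rsc (t : R) : 'rV[R]_D := expR (- lsc t) *: x t.
Definition dev (t : R) : 'rV[R]_D :=
  expR ((L - 1) * lsc t) *: x t - expR (L * lsc t) *: thbar.
Definition res (i : 'I_n) (t : R) : R := f i (x t) - y i.
Definition res2 (t : R) : R := \sum_(i < n) res i t ^+ 2.
Definition rate (t : R) : R := 2 / n%:R * expR (2 * (L - 1) * lsc t).

Lemma x_rsc (t : R) : x t = expR (lsc t) *: rsc t.
Proof. by rewrite scalerA -expRD subrr expR0 scale1r. Qed.

Lemma rsc_dev (t : R) : rsc t - thbar = expR (- (L * lsc t)) *: dev t.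
Proof.
rewrite scalerBr !scalerA -!expRD addNr expR0 scale1r.
by congr (expR _ *: _ - _); ring.
Qed.

Lemma grad_x i (t : R) : grad (f i) (x t) = expR ((L - 1) * lsc t) *: grad (f i) (rsc t).
Proof. by rewrite x_rsc (grad_homogeneous (C1f i) (homf i)). Qed.

Lemma within_x (T : R) : {within `[0, T], continuous x}.
Proof. by apply: continuous_subspaceW cx => t /=; rewrite in_itv/= => /andP[]. Qed.

(** Euler's identity turns the weight decay term into [lam * L * f i (x t)]. Each of the two
    gradients contributes a factor [expR ((L - 1) * lsc t)], and together these make up [rate]. *)
Lemma is_derive_res i (t : R) : 0 < t -> is_derive t 1 (res i)
  (- rate t * dotv (\sum_(k < n) res k t *: grad (f k) (rsc t)) (grad (f i) (rsc t))
   - lam * L * (res i t + y i)).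
Proof.
move=> t0.
have d1 := is_derive_comp_grad (C1f i) (dx t0).
apply: is_derive_eq; rewrite subr0.
rewrite linearN/= dotv_linear linearZ/= (euler_homogeneous (C1f i) (homf i)).
rewrite opprD; congr (_ - _); last by rewrite /res /GRing.scale/=; ring.
rewrite mulNr; congr (- _).
rewrite [X in _ * X = _]dotvC !dotv_suml !mulr_sumr; apply: eq_bigr => k _.
rewrite !grad_x !dotvZl !dotvZr /rate.
have -> : 2 * (L - 1) * lsc t = (L - 1) * lsc t + (L - 1) * lsc t by ring.
by rewrite expRD /res; ring.
Qed.

(** Weight decay on [x] contributes [- lam] and its prefactor [- (L - 1) * lam], so both terms of
    [dev] decay at the common rate [lam * L] and only the loss gradient remains as forcing. *)
Lemma is_derive_dev w (t : R) : 0 < t -> is_derive t 1 (fun u => dotv w (dev u))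
  (- (lam * L) * dotv w (dev t)
   - rate t * \sum_(k < n) res k t * dotv w (grad (f k) (rsc t))).
Proof.
move=> t0.
have d1 := is_derive_dotv_comp w (dx t0).
have d2 := is_derive_expR_affine (L - 1) A lam t.
have d3 := is_derive_expR_affine L A lam t.
have -> : (fun u => dotv w (dev u)) = (fun u => expR ((L - 1) * (A - lam * u)) * dotv w (x u)
    - expR (L * (A - lam * u)) * dotv w thbar).
  by apply/funext => u; rewrite linearB/= !dotvZr.
apply: is_derive_eq; rewrite /GRing.scale/= -/(lsc t).
rewrite linearN/= dotv_linear linearB/= !dotvZr raddf_sum/=.
have -> : \sum_(i < n) dotv w ((f i (x t) - y i) *: grad (f i) (x t)) =
  expR ((L - 1) * lsc t) * \sum_(k < n) res k t * dotv w (grad (f k) (rsc t)).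
  rewrite mulr_sumr; apply: eq_bigr => k _.
  by rewrite grad_x !dotvZr /res; ring.
rewrite /GRing.scale/= /rate.
have -> : 2 * (L - 1) * lsc t = (L - 1) * lsc t + (L - 1) * lsc t by ring.
by rewrite expRD; ring.
Qed.

Lemma is_derive_res2 (t : R) : 0 < t -> is_derive t 1 res2
  (- 2 * rate t * sqnorm (\sum_(k < n) res k t *: grad (f k) (rsc t))
   - 2 * (lam * L) * (res2 t + \sum_(i < n) res i t * y i)).
Proof.
move=> t0; set V := \sum_(k < n) _.
have d1 i : is_derive t 1 (fun u => res i u ^+ 2)
   (2 * (res i t * (- rate t * dotv V (grad (f i) (rsc t)) - lam * L * (res i t + y i)))).
  have d2 := is_derive_res i t0.
  by apply: is_derive_eq; rewrite /GRing.scale/= -/V; ring.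
apply: (is_derive_eq (is_derive_sumf d1)).
rewrite -mulr_sumr.
have -> : sqnorm V = \sum_(i < n) res i t * dotv V (grad (f i) (rsc t)).
  rewrite /sqnorm {2}/V raddf_sum/=; apply: eq_bigr => i _.
  by rewrite dotvZr.
rewrite /res2 -[X in _ = _ - _ * X]big_split/= !mulr_sumr -sumrB.
by apply: eq_bigr => i _; ring.
Qed.

Lemma within_res2 (T : R) : {within `[0, T], continuous res2}.
Proof.
have cf i : continuous (f i).
  by move=> th; apply: differentiable_continuous; have [] := C1_differentiable th (C1f i).
have cr i : {within `[0, T], continuous (res i)}.
  apply: within_continuousB; last exact: within_continuous_cst.
  by apply: (@within_continuous_comp _ _ _ _ x (f i)); [move=> th _; exact: cf | exact: within_x].
move=> t; apply: (@cvg_big R 'I_n +%R) => [|i _]; first exact: add_continuous.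
exact: (@within_continuousM R _ _ _ (cr i) (cr i) t).
Qed.

Lemma within_dev (T : R) : {within `[0, T], continuous dev}.
Proof.
have ce (b : R) : {within `[0, T], continuous (fun t => expR (b * lsc t))}.
  apply: continuous_subspaceT => t; apply: differentiable_continuous.
  by apply/derivable1_diffP; have := is_derive_expR_affine b A lam t => d.
apply: within_continuousB => t.
  have cxT := @within_x T t.
  exact: (continuousZ (ce (L - 1) t) cxT).
exact: (continuousZr_tmp (a := thbar) (ce L t)).
Qed.

Lemma dev0 : dev 0 = 0.
Proof.
rewrite /dev /lsc mulr0 subr0 x0 scalerA -expRD.
by rewrite (_ : (L - 1) * A + A = L * A) ?subrr//; ring.
Qed.

Lemma res2_ge0 (t : R) : 0 <= res2 t.
Proof. by apply: sumr_ge0 => i _; exact: sqr_ge0. Qed.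

Lemma res2_0 : res2 0 <= (\sum_(i < n) `|y i|) ^+ 2.
Proof.
apply: le_trans (sum_sqr_le y); rewrite le_eqVlt; apply/orP; left; apply/eqP.
by apply: eq_bigr => i _; rewrite /res x0 homf f0 mulr0 sub0r sqrrN.
Qed.

Lemma rate_ge0 (t : R) : 0 <= rate t.
Proof. by rewrite mulr_ge0 ?expR_ge0// divr_ge0. Qed.

Lemma rate_le (t : R) : 0 <= t -> rate t <= 2 / n%:R * expR (2 * (L - 1) * A).
Proof.
move=> t0; rewrite ler_wpM2l ?divr_ge0// ler_expR ler_wpM2l//.
  by rewrite mulr_ge0// subr_ge0.
by rewrite gerBl mulr_ge0// ltW.
Qed.

Lemma rate_ge (t : R) : 0 <= lsc t -> 2 / n%:R <= rate t.
Proof.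
move=> t0; rewrite ler_peMr ?divr_ge0// (le_trans _ (expR_ge1Dx _))// lerDl mulr_ge0// mulr_ge0//.
by rewrite subr_ge0.
Qed.

Lemma lamL_gt0 : 0 < lam * L.
Proof. by rewrite mulr_gt0// (lt_le_trans ltr01). Qed.

(** * Estimates while the rescaled trajectory stays near [thbar] *)

Section near_thbar.
Variables (eta k : R).
Hypothesis k0 : 0 < k.
Hypothesis gram : forall th, `|th - thbar| < eta -> forall p : 'I_n -> R,
  k * \sum_(i < n) p i ^+ 2 <= sqnorm (\sum_(i < n) p i *: grad (f i) th).

(** The Gram bound controls the quadratic term and [sum_normM_le] the coupling with [y]. The result
    is the hypothesis on [dZ] shared by [drift_bound] and [residual_decay]. *)
Lemma res2_drift (t : R) : `|rsc t - thbar| < eta ->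
  - 2 * rate t * sqnorm (\sum_(k < n) res k t *: grad (f k) (rsc t))
    - 2 * (lam * L) * (res2 t + \sum_(i < n) res i t * y i)
  <= - 2 * (rate t * k + lam * L) * res2 t
    + 2 * (lam * L) * (\sum_(i < n) `|y i|) * Num.sqrt (res2 t).
Proof.
move=> /gram /(_ (res^~ t)) H.
have H1 := ler_wpM2l (rate_ge0 t) H.
have H2 : - \sum_(i < n) res i t * y i <= Num.sqrt (res2 t) * \sum_(i < n) `|y i|.
  by apply: le_trans (sum_normM_le _ _); rewrite -normrN ler_norm.
have H3 := ler_wpM2l (ltW lamL_gt0) H2.
rewrite -/(res2 t) in H1.
set S := sqnorm _ in H1 *; set P := \sum_(i < n) res i t * y i in H3 *.
set Y := \sum_(i < n) `|y i| in H3 *; set z := Num.sqrt _ in H3 *.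
have -> : - 2 * rate t * S - 2 * (lam * L) * (res2 t + P) =
  - 2 * (rate t * S) - 2 * (lam * L) * res2 t + 2 * (lam * L * (- P)) by ring.
have -> : - 2 * (rate t * k + lam * L) * res2 t + 2 * (lam * L) * Y * z =
  - 2 * (rate t * (k * res2 t)) - 2 * (lam * L) * res2 t + 2 * (lam * L * (z * Y)) by ring.
lra.
Qed.

(** This is [drift_bound] with [q = dotv w dev] and [Z = res2]; [n%:R] comes from summing the bound
    [b] over the data. The estimate is uniform in [T], [lam] and the initialization scale. *)
Lemma dev_drift w (b T : R) : 0 <= T -> 0 <= b ->
  (forall th, `|th - thbar| < eta -> forall i, `|dotv w (grad (f i) th)| <= b) ->
  (forall t : R, 0 < t < T -> `|rsc t - thbar| < eta) ->
  `|dotv w (dev T)| <= n%:R * b * (\sum_(i < n) `|y i|) / k.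
Proof.
move=> T0 b0 Hb nearT.
apply: (@drift_bound R (fun u => dotv w (dev u)) _ res2 _ rate T (lam * L) k _ _
  (2 / n%:R * expR (2 * (L - 1) * A)) T0 lamL_gt0 k0).
- by rewrite mulr_ge0.
- by rewrite sumr_ge0.
- apply: (@within_continuous_comp _ _ _ _ dev (dotv w)) (within_dev (T := T)) => th _.
  exact: continuous_dotv.
- exact: within_res2.
- by move=> t /andP[t0 _]; exact: is_derive_dev.
- by move=> t /andP[t0 _]; exact: is_derive_res2.
- by move=> t /andP[t0 _]; rewrite rate_ge0 rate_le// ltW.
- exact: res2_ge0.
- move=> t /[dup] tT /nearT tn.
  rewrite mulNr addrAC addNr add0r normrN normrM ger0_norm ?rate_ge0//.
  rewrite -mulrA ler_wpM2l ?rate_ge0// mulrC.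
  apply: le_trans (sum_normM_le _ _) _; rewrite -/(res2 t) ler_wpM2l ?sqrtr_ge0//.
  apply: (@le_trans _ _ (\sum_(i < n) b)).
    by apply: ler_sum => i _; exact: Hb.
  by rewrite sumr_const card_ord mulr_natl.
- by move=> t /nearT tn; exact: res2_drift.
- by rewrite dev0 raddf0.
- exact: res2_0.
Qed.

(** If earlier times are near [thbar], [dev_drift] with [w = unitv j] bounds every coordinate of
    [dev] by [M - 1]; the gap [1] gives the strict inequality that the bootstrap requires. *)
Lemma dev_lt (B T : R) : 0 <= B ->
  (forall th, `|th - thbar| < eta -> forall i, `|grad (f i) th| <= B) ->
  let M := n%:R * B * (\sum_(i < n) `|y i|) / k + 1 in
  (forall t : R, 0 <= t <= T -> expR (- (L * lsc t)) * M < eta) ->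
  forall t : R, 0 <= t <= T -> `|dev t| < M.
Proof.
move=> B0 HB M HM; apply: continuity_bootstrap.
  apply: (@within_continuous_comp _ _ _ _ dev Num.norm) (within_dev (T := T)) => th _.
  exact: norm_continuous.
move=> t /andP[t0 tT] IH.
have Y0 : 0 <= n%:R * B * (\sum_(i < n) `|y i|) / k.
  by rewrite divr_ge0 ?(ltW k0)// mulr_ge0 ?sumr_ge0// mulr_ge0.
apply: (@le_lt_trans _ _ (n%:R * B * (\sum_(i < n) `|y i|) / k)); last by rewrite ltrDl.
apply: norm_le_coord => // j; rewrite -dotv_unitv dotvC.
apply: dev_drift => //.
  by move=> th /HB H i; rewrite dotvC dotv_unitv (le_trans (coord_le_norm _ _)).
move=> u /andP[u0 ut]; rewrite rsc_dev normrZ ger0_norm ?expR_ge0//.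
apply: le_lt_trans (HM u _); last by rewrite (ltW u0) (le_trans (ltW ut)).
by rewrite ler_wpM2l ?expR_ge0// ltW// IH// (ltW u0).
Qed.

(** As long as [lsc] is nonnegative, [rate] is at least [2 / n%:R], so the damping [2 * rate * k] is
    at least [4 * k / n%:R] whatever the scale. *)
Lemma res2_decay (T : R) : 0 <= T ->
  (forall t : R, 0 <= t <= T -> 0 <= lsc t) ->
  (forall t : R, 0 < t < T -> `|rsc t - thbar| < eta) ->
  res2 T <= lam * L * (\sum_(i < n) `|y i|) ^+ 2 / (2 * (4 * k / n%:R)) +
            expR (- (4 * k / n%:R * T)) * (\sum_(i < n) `|y i|) ^+ 2.
Proof.
move=> T0 s0 nearT; set nu := 4 * k / _; set Y := (\sum_(i < n) _).
apply: (@residual_decay R res2 _ rate T (lam * L) k Y nu) => //.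
- exact: lamL_gt0.
- by rewrite divr_gt0 ?mulr_gt0// ltr0n.
- exact: ltW.
- exact: within_res2.
- by move=> t /andP[t0 _]; exact: is_derive_res2.
- move=> t /andP[t0 tT]; rewrite /nu.
  have := rate_ge (s0 t _); rewrite (ltW t0) (ltW tT) => /(_ isT) H.
  have -> : 4 * k / n%:R = 2 * (2 / n%:R) * k.
    by field; rewrite pnatr_eq0 -lt0n.
  by rewrite ler_pM2r// ler_pM2l.
- exact: res2_ge0.
- by move=> t /nearT tn; exact: res2_drift.
- exact: res2_0.
Qed.

End near_thbar.

(** Multiply the first-order estimate at [rsc t] by [expR (L * lsc t)]: homogeneity turns
    [g (rsc t)] into [g (x t)], and the displacement becomes [dev t]. *)
Lemma homogeneous_dev (g : 'rV[R]_D -> R) (G : 'rV[R]_D) (e t : R) :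
  (forall (s : R) th, g (expR s *: th) = expR (L * s) * g th) ->
  `|g (rsc t) - dotv G (rsc t - thbar)| <= e * `|rsc t - thbar| ->
  `|g (x t) - dotv G (dev t)| <= e * `|dev t|.
Proof.
move=> homg.
have -> : dev t = expR (L * lsc t) *: (rsc t - thbar).
  by rewrite rsc_dev scalerA -expRD subrr expR0 scale1r.
rewrite x_rsc homg dotvZr -mulrBr normrM normrZ mulrCA => H.
by rewrite ler_wpM2l.
Qed.

End flow.

(** * Linear algebra of the gradients *)

(** The columns of a right inverse of the matrix read off the coefficients of a combination of its
    rows. *)
Lemma row_free_pseudo_inverse (R : realType) (D n : nat) (g : 'I_n -> 'rV[R]_D) :
  row_free (\matrix_(i < n) g i) ->
  exists P : 'I_n -> 'rV[R]_D, forall (p : 'I_n -> R) (c : 'I_n),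
    p c = dotv (\sum_(i < n) p i *: g i) (P c).
Proof.
move=> /row_freeP[P GP].
exists (fun c => \row_j P j c) => p c.
have E : \sum_(i < n) p i *: g i = (\row_i p i) *m (\matrix_(i < n) g i).
  by rewrite mulmx_sum_row; apply: eq_bigr => i _; rewrite mxE rowK.
have -> : p c = ((\row_i p i) *m (\matrix_(i < n) g i) *m P) 0 c.
  by rewrite -mulmxA GP mulmx1 mxE.
by rewrite -E mxE; apply: eq_bigr => j _; rewrite mxE.
Qed.

Lemma normr_le_sqrt_sqnorm (R : realType) (D : nat) (v : 'rV[R]_D) :
  `|v| <= Num.sqrt (sqnorm v).
Proof.
apply: norm_le_coord => [|j]; first exact: sqrtr_ge0.
have S0 (P : pred 'I_D) : 0 <= \sum_(i < D | P i) v 0 i * v 0 i.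
  by apply: sumr_ge0 => i _; rewrite -expr2 sqr_ge0.
rewrite -sqrtr_sqr ler_sqrt; last exact: S0.
by rewrite /sqnorm /dotv (bigD1 j)//= expr2 lerDl.
Qed.

(** The right inverse bounds each coefficient by the norm of the combination of the [g i]; replacing
    [g] by [g'] costs at most half of the norm of [p], which is absorbed on the left. *)
Lemma gram_lower_bound (R : realType) (D n : nat) (g : 'I_n -> 'rV[R]_D) :
  row_free (\matrix_(i < n) g i) ->
  exists k e : R, [/\ 0 < k, 0 < e & forall g' : 'I_n -> 'rV[R]_D,
    (forall i, `|g' i - g i| <= e) -> forall p : 'I_n -> R,
    k * \sum_(i < n) p i ^+ 2 <= sqnorm (\sum_(i < n) p i *: g' i)].
Proof.
move=> /row_free_pseudo_inverse[P HP].
pose C : R := D%:R * \sum_(c < n) `|P c| + 1.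
have C0 : 0 < C by rewrite ltr_wpDl// mulr_ge0// sumr_ge0.
pose N : R := n%:R + 1.
have N0 : 0 < N by rewrite ltr_wpDl.
(* The second witness makes the perturbation term [N * C * (N * z * e)] equal to [z / 2]. What
   remains is [z <= 2 * N * C * v], whose square gives the first. *)
exists ((2 * N * C) ^+ 2)^-1, (2 * N * N * C)^-1; split.
- by rewrite invr_gt0 exprn_gt0// !mulr_gt0.
- by rewrite invr_gt0 !mulr_gt0.
move=> g' Hg p.
set V := \sum_(i < n) p i *: g' i; set z := Num.sqrt (\sum_(i < n) p i ^+ 2).
pose v := Num.sqrt (sqnorm V).
have z0 : 0 <= z by exact: sqrtr_ge0.
have sq0 : 0 <= \sum_(i < n) p i ^+ 2 by apply: sumr_ge0 => i _; exact: sqr_ge0.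
have zz : z ^+ 2 = \sum_(i < n) p i ^+ 2 by rewrite sqr_sqrtr.
have V0 : 0 <= sqnorm V by apply: sumr_ge0 => i _; rewrite -expr2 sqr_ge0.
have pz i : `|p i| <= z.
  rewrite -sqrtr_sqr ler_sqrt// (bigD1 i)//= lerDl sumr_ge0// => j _.
  exact: sqr_ge0.
pose e := (2 * N * N * C)^-1.
have e0 : 0 < e by rewrite invr_gt0 !mulr_gt0.
have pc c : `|p c| <= C * (v + N * z * e).
  rewrite (HP p c).
  have -> : \sum_(i < n) p i *: g i = V + \sum_(i < n) p i *: (g i - g' i).
    rewrite -big_split/=; apply: eq_bigr => i _; by rewrite -scalerDr addrC subrK.
  set E := \sum_(i < n) p i *: (g i - g' i).
  apply: le_trans (normr_dotv_le _ _) _.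
  rewrite mulrAC; apply: ler_pM => //.
  - rewrite /C; apply: ler_wpDr => //; rewrite ler_wpM2l//.
    by rewrite (bigD1 c)//= lerDl sumr_ge0.
  - apply: le_trans (ler_normD _ _) _; apply: lerD; first exact: normr_le_sqrt_sqnorm.
    apply: le_trans (ler_norm_sum _ _ _) _.
    apply: (@le_trans _ _ (\sum_(i < n) z * e)).
      by apply: ler_sum => i _; rewrite normrZ distrC ler_pM// Hg.
    rewrite sumr_const card_ord -mulrA -mulr_natl ler_wpM2r ?mulr_ge0 ?(ltW e0)//.
    by rewrite lerDl.
have zle : z <= N * (C * (v + N * z * e)).
  apply: (@le_trans _ _ (\sum_(i < n) `|p i|)).
    rewrite -(@ler_pXn2r _ 2)// ?nnegrE ?sumr_ge0// zz; exact: sum_sqr_le.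
  apply: le_trans (ler_sum _ (fun i _ => pc i)) _.
  rewrite sumr_const card_ord -mulr_natl ler_wpM2r ?lerDl//.
  by rewrite mulr_ge0 ?(ltW C0)// addr_ge0 ?sqrtr_ge0// !mulr_ge0 ?(ltW N0) ?(ltW e0).
have zle2 : z <= 2 * N * C * v.
  have E : N * (C * (v + N * z * e)) = N * C * v + z / 2.
    by rewrite /e; field; rewrite !gt_eqF.
  rewrite E in zle.
  have -> : 2 * N * C * v = 2 * (N * C * v) by ring.
  lra.
rewrite -zz -[X in _ <= X]sqr_sqrtr// -/v.
rewrite ler_pdivrMl ?exprn_gt0 ?mulr_gt0// -exprMn.
rewrite ler_pXn2r// nnegrE !mulr_ge0 ?sqrtr_ge0//; exact: ltW.
Qed.

(** Orthogonal projection on the row span: [a] solves the normal equations. Their matrix [G *m G^T]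
    is invertible, since a [p] in its kernel has [sqnorm (p *m G) = 0], hence [p = 0]. *)
Lemma orthogonal_decomposition (R : realType) (D n : nat) (g : 'I_n -> 'rV[R]_D)
    (v : 'rV[R]_D) :
  row_free (\matrix_(i < n) g i) ->
  exists (a : 'I_n -> R) (w : 'rV[R]_D),
    v = \sum_(i < n) a i *: g i + w /\ forall i, dotv (g i) w = 0.
Proof.
set G := \matrix_(i < n) g i => rfG.
have uG : G *m G^T \in unitmx.
  rewrite -row_free_unit; apply: inj_row_free => p pG.
  have pG0 : p *m G = 0.
    have : sqnorm (p *m G) = 0.
      have E : (p *m G) *m (p *m G)^T = 0.
        by rewrite trmx_mul mulmxA -(mulmxA p) pG mul0mx.
      have := congr1 (fun A : 'M[R]_1 => A 0 0) E; rewrite /= [RHS]mxE mxE => <-.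
      by apply: eq_bigr => i _; rewrite [(_^T) _ _]mxE.
    move=> /eqP; rewrite psumr_eq0 => [/allP H|i _]; last by rewrite -expr2 sqr_ge0.
    apply/rowP => j; rewrite [RHS]mxE; have := H j (mem_index_enum _).
    by rewrite mulf_eq0 orbb => /eqP.
  by apply/eqP; rewrite -(mulmx_free_eq0 _ rfG) pG0.
pose a := v *m G^T *m invmx (G *m G^T).
exists (fun i => a 0 i), (v - a *m G); split.
  have -> : \sum_(i < n) a 0 i *: g i = a *m G.
    by rewrite mulmx_sum_row; apply: eq_bigr => i _; rewrite rowK.
  by rewrite addrC subrK.
move=> i.
have : (v - a *m G) *m G^T = 0.
  by rewrite mulmxBl -mulmxA /a mulmxKV ?subrr.
move=> /(congr1 (fun A : 'rV[R]_n => A 0 i)); rewrite /= [RHS]mxE mxE => <-.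
by apply: eq_bigr => j _; rewrite [(_^T) _ _]mxE [G _ _]mxE mulrC.
Qed.

(** Moving [h] along [w] preserves the constraints, so minimality on this line makes the first-order
    term vanish. *)
Lemma min_norm_interp_orthogonal (R : realType) (D n : nat)
    (g : 'I_n -> 'rV[R]_D) (ys : 'I_n -> R) (h w : 'rV[R]_D) :
  is_min_norm_interp g ys h -> (forall i, dotv (g i) w = 0) -> dotv w h = 0.
Proof.
move=> [Hh Hmin] Hw; set c := dotv w h; set s := sqnorm w.
have s0 : 0 <= s by apply: sumr_ge0 => i _; rewrite -expr2 sqr_ge0.
have s1 : 0 < s + 1 by rewrite ltr_wpDl.
(* The minimizer on the line is [- (c / s)]; the denominator [s + 1] also covers [w = 0] and still
   decreases the squared norm unless [c = 0]. *)
pose t := - (c / (s + 1)).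
have /Hmin : forall i, dotv (g i) (t *: w + h) = ys i.
  by move=> i; rewrite dotv_linear Hw mulr0 add0r Hh.
have -> : sqnorm (t *: w + h) = t ^+ 2 * s + 2 * (t * c) + sqnorm h.
  rewrite {1}/sqnorm dotv_linear ![dotv (_ + _) _]dotvC !dotv_linear.
  by rewrite [dotv h w]dotvC -/c -/(sqnorm w) -/(sqnorm h) -/s; ring.
rewrite ler_pM2r ?invr_gt0// => H.
have {}H : 0 <= t ^+ 2 * s + 2 * (t * c) by move: H; lra.
have E : t ^+ 2 * s + 2 * (t * c) = - (c ^+ 2 * (s + 2) / (s + 1) ^+ 2).
  by rewrite /t; field; rewrite gt_eqF.
move: H; rewrite E oppr_ge0 pmulr_lle0 ?invr_gt0 ?exprn_gt0//.
rewrite pmulr_lle0 ?ltr_wpDl// => c2.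
by apply/eqP; rewrite -sqrf_eq0 eq_le c2 sqr_ge0.
Qed.

(** * The prediction at one initialization scale *)

Lemma near_pinfty_le_ln (R : realType) (N : R) : \forall a \near +oo, N <= ln a.
Proof.
near=> a.
have : expR N <= a by near: a; apply: nbhs_pinfty_ge; exact: num_real.
by move=> Na; rewrite -[N]expRK ler_ln ?posrE ?expR_gt0// (lt_le_trans (expR_gt0 N)).
Unshelve. all: by end_near. Qed.

Lemma near_pinfty_expR_ln_lt (R : realType) (K k e : R) : 0 < k -> 0 < e ->
  \forall a \near +oo, K * expR (- (k * ln a)) < e.
Proof.
move=> k0 e0; apply: filterS (near_pinfty_le_ln (`|K| / (e * k))) => a Na.
rewrite expRN ltr_pdivrMr ?expR_gt0//.
apply: le_lt_trans (ler_norm K) _.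
apply: lt_le_trans (_ : e * (1 + k * ln a) <= _); last by rewrite ler_pM2l// expR_ge1Dx.
move: Na; rewrite ler_pdivrMr ?mulr_gt0//.
have -> : ln a * (e * k) = e * (k * ln a) by ring.
by rewrite mulrDr mulr1; lra.
Qed.

(** Serves the case without data, where the flow is linear. [gronwall_affine] bounds every linear
    form from above, and opposite forms give equality. *)
Lemma weight_decay_flow (R : realType) (D : nat) (x : R -> 'rV[R]_D) (lam T : R) :
  0 <= T -> {within `[0, T], continuous x} ->
  (forall t : R, 0 < t -> is_derive t 1 x (- (lam *: x t))) ->
  x T = expR (- (lam * T)) *: x 0.
Proof.
move=> T0 cx dx.
have H (w : 'rV[R]_D) : dotv w (x T) <= expR (- (lam * T)) * dotv w (x 0).
  have := @gronwall_affine R (fun t => dotv w (x t)) (fun t => dotv w (- (lam *: x t)))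
    lam 0 T T0.
  rewrite !subr0; apply.
  - apply: (@within_continuous_comp _ _ _ _ x (dotv w)) cx => th _.
    exact: continuous_dotv.
  - by move=> t /andP[t0 _]; apply: is_derive_dotv_comp; exact: dx.
  - by move=> t _; rewrite linearN/= dotvZr addNr mulr0.
have dotvNl (u v : 'rV[R]_D) : dotv (- u) v = - dotv u v.
  by rewrite dotvC linearN/= dotvC.
apply/rowP => j; rewrite mxE -!dotv_unitv ![dotv _ (unitv j)]dotvC.
by apply/eqP; rewrite eq_le H -lerN2 -mulrN -!dotvNl H.
Qed.

Section one_scale.
Context {R : realType} {D n : nat}.
Variables (f : 'I_n -> 'rV[R]_D -> R) (g : 'rV[R]_D -> R) (y : 'I_n -> R) (L : R).
Variables (thbar hstar : 'rV[R]_D).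
Hypothesis C1f : forall i, C1 (f i).
Hypothesis C1g : C1 g.
Hypothesis homf : forall i (s : R) th, f i (expR s *: th) = expR (L * s) * f i th.
Hypothesis homg : forall (s : R) th, g (expR s *: th) = expR (L * s) * g th.
Hypothesis f0 : forall i, f i thbar = 0.
Hypothesis g0 : g thbar = 0.
Hypothesis n0 : (0 < n)%N.
Hypothesis L1 : 1 <= L.
Hypothesis rf : row_free (\matrix_(i < n) grad (f i) thbar).
Hypothesis minh : is_min_norm_interp (fun i => grad (f i) thbar) y hstar.

Lemma near_grad (h : 'rV[R]_D -> R) (e : R) : C1 h -> 0 < e ->
  \forall th \near thbar, `|grad h th - grad h thbar| <= e.
Proof.
move=> [_ ch] e0.
have : \forall th \near thbar, forall j : 'I_D,
    `|'D_(unitv j) h th - 'D_(unitv j) h thbar| <= e.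
  apply: (@filter_forall _ 'I_D
    (fun j th => `|'D_(unitv j) h th - 'D_(unitv j) h thbar| <= e) _ (nbhs_filter thbar)) => j.
  by have /cvgrPdist_le/(_ e e0) := ch j thbar; apply: filterS => th; rewrite distrC.
apply: filterS => th H; apply: norm_le_coord; first exact: ltW.
by move=> j; rewrite !mxE.
Qed.

(* The error splits along [grad g thbar = sum a_i grad (f i) thbar + w]: the
   first part is controlled by the residuals, the second by the drift of the
   trajectory orthogonally to the gradients. *)
Lemma flow_prediction_estimate (e : R) : 0 < e ->
  exists K1 K2 K3 d : R, [/\ 0 <= K1, 0 <= K2, 0 < K3, 0 < d &
  forall (A lam T : R) (x : R -> 'rV[R]_D),
  0 < lam -> 0 <= T -> x 0 = expR A *: thbar ->
  {within [set t : R | 0 <= t], continuous x} ->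
  (forall t : R, 0 < t -> is_derive t 1 x
    (- ((2 / n%:R) *: \sum_(i < n) (f i (x t) - y i) *: grad (f i) (x t) + lam *: x t))) ->
  0 <= A - lam * T ->
  K1 * expR (- (L * (A - lam * T))) < d ->
  K2 * (lam + expR (- (K3 * T))) < d ->
  `|g (x T) - dotv (grad g thbar) hstar| <= e].
Proof.
move=> e0.
have [k [e1 [k0 e10 Hk]]] := gram_lower_bound rf.
pose B : R := \sum_(i < n) `|grad (f i) thbar| + 1.
have B0 : 0 <= B by rewrite addr_ge0// sumr_ge0.
pose Y : R := \sum_(i < n) `|y i|.
have Y0 : 0 <= Y by rewrite sumr_ge0.
pose M : R := n%:R * B * Y / k + 1.
have M0 : 0 < M by rewrite ltr_wpDl// divr_ge0 ?(ltW k0)// !mulr_ge0.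
have [a [w [gE wE]]] := orthogonal_decomposition (grad g thbar) rf.
pose S : R := \sum_(i < n) `|a i|.
have S0 : 0 <= S by rewrite sumr_ge0.
(* [Q] and [S] are the coefficients of [e2] and [rho] in the final error; the choices of [e2] and
   [rho] make each share at most [e / 2]. *)
pose Q : R := M + S * M + n%:R * (D%:R * `|w|) * Y / k.
have Q0 : 0 <= Q.
  have : 0 <= n%:R * (D%:R * `|w|) * Y / k by rewrite divr_ge0 ?(ltW k0)// !mulr_ge0.
  have : 0 <= S * M by rewrite mulr_ge0// ltW.
  rewrite /Q; lra.
pose e2 : R := e / 2 / (Q + 1).
have e20 : 0 < e2 by rewrite !divr_gt0// ltr_wpDl.
pose rho : R := e / 2 / (S + 1).
have rho0 : 0 < rho by rewrite !divr_gt0// ltr_wpDl.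
(* The radius [e1] serves the Gram bound, [1] the gradient bound [B], and [e2] the
   near-orthogonality to [w]; the last two items linearize the data outputs and [g]. *)
have Hnear : \forall th \near thbar,
  [/\ forall i, `|grad (f i) th - grad (f i) thbar| <= e1,
      forall i, `|grad (f i) th - grad (f i) thbar| <= 1,
      forall i, `|grad (f i) th - grad (f i) thbar| <= e2,
      forall i, `|f i th - f i thbar - dotv (grad (f i) thbar) (th - thbar)| <= e2 * `|th - thbar|
    & `|g th - g thbar - dotv (grad g thbar) (th - thbar)| <= e2 * `|th - thbar|].
  have G (r : R) : 0 < r ->
      \forall th \near thbar, forall i, `|grad (f i) th - grad (f i) thbar| <= r.
    move=> r0; apply: (@filter_forall _ 'I_n
      (fun i th => `|grad (f i) th - grad (f i) thbar| <= r) _ (nbhs_filter thbar)) => i.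
    exact: near_grad.
  have F : \forall th \near thbar, forall i,
      `|f i th - f i thbar - dotv (grad (f i) thbar) (th - thbar)| <= e2 * `|th - thbar|.
    apply: (@filter_forall _ 'I_n (fun i th =>
      `|f i th - f i thbar - dotv (grad (f i) thbar) (th - thbar)| <= e2 * `|th - thbar|)
      _ (nbhs_filter thbar)) => i.
    exact: C1_expansion.
  have G1 := G e1 e10; have G2 := G 1 ltr01; have G3 := G e2 e20.
  have G4 := C1_expansion thbar C1g e20.
  by near=> th; split; near: th.
move: Hnear => /nbhs_ballP[eta /= eta0 Heta].
have {}Heta th : `|th - thbar| < eta ->
  [/\ forall i, `|grad (f i) th - grad (f i) thbar| <= e1,
      forall i, `|grad (f i) th - grad (f i) thbar| <= 1,
      forall i, `|grad (f i) th - grad (f i) thbar| <= e2,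
      forall i, `|f i th - dotv (grad (f i) thbar) (th - thbar)| <= e2 * `|th - thbar|
    & `|g th - dotv (grad g thbar) (th - thbar)| <= e2 * `|th - thbar|].
  move=> H; have := Heta th; rewrite -ball_normE /ball_/= distrC => /(_ H)[? ? ? F G].
  rewrite g0 subr0 in G.
  by split=> // i; have := F i; rewrite f0 subr0.
have gram th : `|th - thbar| < eta -> forall p : 'I_n -> R,
    k * \sum_(i < n) p i ^+ 2 <= sqnorm (\sum_(i < n) p i *: grad (f i) th).
  by move=> /Heta[H _ _ _ _]; exact: Hk.
have gradB th : `|th - thbar| < eta -> forall i, `|grad (f i) th| <= B.
  move=> /Heta[_ H _ _ _] i.
  rewrite -[grad (f i) th](subrK (grad (f i) thbar)) (le_trans (ler_normD _ _))//.
  rewrite addrC lerD// ?H//.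
  by rewrite (bigD1 i)//= lerDl sumr_ge0.
have gradw th : `|th - thbar| < eta -> forall i,
    `|dotv w (grad (f i) th)| <= D%:R * `|w| * e2.
  move=> /Heta[_ _ H _ _] i.
  rewrite -[grad (f i) th](subrK (grad (f i) thbar)) raddfD/= [dotv w (grad _ thbar)]dotvC wE.
  by rewrite addr0 (le_trans (normr_dotv_le _ _))// ler_wpM2l// mulr_ge0.
pose nu : R := 4 * k / n%:R.
have nu0 : 0 < nu by rewrite divr_gt0 ?mulr_gt0// ltr0n.
pose K : R := L * Y ^+ 2 / (2 * nu) + Y ^+ 2.
have L0 : 0 <= L by rewrite (le_trans ler01).
have LY0 : 0 <= L * Y ^+ 2 / (2 * nu).
  by rewrite divr_ge0 ?mulr_ge0 ?sqr_ge0// ltW.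
have K0 : 0 <= K by rewrite addr_ge0 ?sqr_ge0.
(* [eta] keeps the trajectory near [thbar], and [rho ^+ 2] bounds the squared residual. [K]
   dominates the coefficients of both terms in [res2_decay]. *)
exists M, K, nu, (Num.min eta (rho ^+ 2)).
split => //; rewrite ?(ltW M0)//; first by rewrite lt_min eta0 exprn_gt0.
move=> A lam T x lam0 T0 x0 cx dx AT; rewrite !lt_min => /andP[Meta _] /andP[_ Krho].
(* [lsc] decreases, so the smallness condition at [T] covers all earlier times. *)
have lscT (t : R) : 0 <= t <= T -> A - lam * T <= lsc A lam t.
  by move=> /andP[t0 tT]; rewrite /lsc lerD2l lerN2 ler_pM2l.
have devM : forall t : R, 0 <= t <= T -> `|dev L A lam x thbar t| < M.
  apply: (dev_lt C1f homf f0 L1 lam0 x0 cx dx k0 gram B0 gradB).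
  move=> t tT; rewrite mulrC; apply: le_lt_trans Meta.
  by rewrite ler_wpM2l ?(ltW M0)// ler_expR lerN2 ler_wpM2l// lscT.
have rscT : forall t : R, 0 <= t <= T -> `|rsc A lam x t - thbar| < eta.
  move=> t tT; rewrite (@rsc_dev _ _ L) normrZ ger0_norm ?expR_ge0//.
  apply: le_lt_trans Meta; rewrite mulrC ler_pM ?expR_ge0// ?(ltW (devM t tT))//.
  by rewrite ler_expR lerN2 ler_wpM2l// lscT.
have rscT' (t : R) : 0 < t < T -> `|rsc A lam x t - thbar| < eta.
  by move=> /andP[t0 tT]; apply: rscT; rewrite !ltW.
have TT : 0 <= T <= T by rewrite T0 lexx.
have hM := devM T TT; set h := dev L A lam x thbar T in hM.
have Hres : forall i, `|f i (x T) - y i| <= rho.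
  move=> i.
  have R2 : res2 f y x T <= rho ^+ 2.
    apply: le_trans (res2_decay C1f homf f0 n0 L1 lam0 x0 cx dx k0 gram T0 _ rscT') _.
      by move=> t /lscT; exact: le_trans.
    apply: le_trans (ltW Krho); rewrite -/Y -/nu.
    have E1 : 0 <= lam * Y ^+ 2 by rewrite mulr_ge0 ?sqr_ge0// ltW.
    have E2 : 0 <= L * Y ^+ 2 / (2 * nu) * expR (- (nu * T)) by rewrite mulr_ge0 ?expR_ge0.
    have -> : K * (lam + expR (- (nu * T))) = lam * L * Y ^+ 2 / (2 * nu) +
      expR (- (nu * T)) * Y ^+ 2 + lam * Y ^+ 2 + L * Y ^+ 2 / (2 * nu) * expR (- (nu * T)).
      by rewrite /K; ring.
    lra.
  rewrite -(@ler_pXn2r _ 2)// ?nnegrE ?(ltW rho0)// real_normK ?num_real//.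
  apply: le_trans R2; rewrite /res2 (bigD1 i)//= lerDl sumr_ge0// => j _.
  exact: sqr_ge0.
have [_ _ _ Ff Fg] := Heta _ (rscT T TT).
have e2h : e2 * `|h| <= e2 * M by rewrite ler_pM2l// ltW.
have Hf i : `|f i (x T) - dotv (grad (f i) thbar) h| <= e2 * M.
  exact: le_trans (homogeneous_dev (homf i) (Ff i)) e2h.
have Hg : `|g (x T) - dotv (grad g thbar) h| <= e2 * M.
  exact: le_trans (homogeneous_dev homg Fg) e2h.
(* As [w] is orthogonal to the gradients at [thbar], those nearby are almost orthogonal to it, which
   puts the small factor [e2] into the drift bound. *)
have Hw : `|dotv w h| <= n%:R * (D%:R * `|w| * e2) * Y / k.
  apply: (dev_drift C1f homf f0 L1 lam0 x0 cx dx k0 gram T0 _ gradw rscT').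
  by rewrite mulr_ge0 ?(ltW e20)// mulr_ge0.
have wh : dotv w hstar = 0 := min_norm_interp_orthogonal minh wE.
have Hgh : `|dotv (grad g thbar) h - dotv (grad g thbar) hstar| <=
    S * (e2 * M + rho) + n%:R * (D%:R * `|w| * e2) * Y / k.
  have dg (u : 'rV[R]_D) : dotv (grad g thbar) u =
      \sum_(i < n) a i * dotv (grad (f i) thbar) u + dotv w u.
    rewrite gE dotvC raddfD/= [dotv u w]dotvC; congr (_ + _).
    by rewrite dotvC dotv_suml; apply: eq_bigr => i _; rewrite dotvZl.
  rewrite !dg wh addr0 addrAC -sumrB (le_trans (ler_normD _ _))// lerD//.
  apply: le_trans (ler_norm_sum _ _ _) _; rewrite mulr_suml; apply: ler_sum => i _.
  rewrite -mulrBr normrM ler_wpM2l// minh.1.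
  (* Passing through [f i (x T)] separates the linearization error from the residual. *)
  rewrite -(subrKA (f i (x T))) (le_trans (ler_normD _ _))// lerD//.
  by rewrite distrC.
rewrite -(subrKA (dotv (grad g thbar) h)) (le_trans (ler_normD _ _))//.
apply: le_trans (lerD Hg Hgh) _.
have -> : e2 * M + (S * (e2 * M + rho) + n%:R * (D%:R * `|w| * e2) * Y / k) =
  e2 * Q + S * rho by rewrite /Q; ring.
have A1 : e2 * Q <= e / 2.
  by rewrite /e2 mulrAC ler_pdivrMr ?ltr_wpDl// ler_pM2l ?divr_gt0// lerDl.
have A2 : S * rho <= e / 2.
  by rewrite /rho mulrA ler_pdivrMr ?ltr_wpDl// [S * _]mulrC ler_pM2l ?divr_gt0// lerDl.
lra.
Unshelve. all: by end_near. Qed.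

End one_scale.

(** * The limit of infinite initialization scale *)

Unset Implicit Arguments. Set Strict Implicit.

Theorem theorem3p3 (R : realType) (X : Type) (D n : nat)
  (f : 'rV[R]_D -> X -> R) (L : R) (xs : 'I_n -> X) (ys : 'I_n -> R)
  (thbar : 'rV[R]_D) (p : R) (lam : R -> R) (traj : R -> R -> 'rV[R]_D)
  (hstar : 'rV[R]_D) (c : R) :
  (forall x : X, C2 (fun th => f th x)) ->
  (forall (x : X) (a : R) (th : 'rV[R]_D), 0 < a -> f (a *: th) x = a `^ L * f th x) ->
  (forall x : X, f thbar x = 0) ->
  0 < p -> Theta_neg_pow lam p ->
  (forall a : R, 0 < a -> 0 < lam a ->
     gradient_flow (lossreg f xs ys (lam a)) (a *: thbar) (traj a)) ->
  row_free (\matrix_(i < n) grad (fun th => f th (xs i)) thbar) ->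
  is_min_norm_interp (fun i => grad (fun th => f th (xs i)) thbar) ys hstar ->
  0 < c < 1 ->
  forall x : X,
    (fun a : R => f (traj a ((1 - c) / lam a * ln a)) x) @ +oo
      --> dotv (grad (fun th => f th x) thbar) hstar.
Proof.
move=> C2f Hom f0 p0 [c1 [c2 [a0 [c10 [c20 Hlam]]]]] flow rf minh /andP[c_gt0 c_lt1] x.
have C1f z := C2_C1 (C2f z).
have hom z (s : R) th : f (expR s *: th) z = expR (L * s) * f th z.
  by rewrite Hom ?expR_gt0// /powR gt_eqF ?expR_gt0// expRK.
pose T (a : R) : R := (1 - c) / lam a * ln a.
have Hflow : \forall a \near +oo, [/\ 0 < lam a, lam a <= c2 * expR (- (p * ln a)), 0 <= ln a,
    traj a 0 = expR (ln a) *: thbar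
  & {within [set t : R | 0 <= t], continuous (traj a)} /\
    forall t : R, 0 < t -> is_derive t 1 (traj a)
      (- ((2 / n%:R) *: \sum_(i < n) (f (traj a t) (xs i) - ys i) *:
            grad (fun th => f th (xs i)) (traj a t) + lam a *: traj a t))].
  near=> a.
  have a_gt0 : 0 < a by near: a; apply: nbhs_pinfty_gt; exact: num_real.
  have /Hlam[lam1 lam2] : a0 <= a by near: a; apply: nbhs_pinfty_ge; exact: num_real.
  have lam_gt0 : 0 < lam a by rewrite (lt_le_trans _ lam1)// mulr_gt0// powR_gt0.
  have [tr0 [ctr dtr]] := flow a a_gt0 lam_gt0.
  split=> //.
  - by move: lam2; rewrite /powR gt_eqF// mulNr.
  - by near: a; exact: near_pinfty_le_ln.
  - by rewrite lnK ?posrE.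
  - by split=> // t /dtr; rewrite grad_lossreg.
have T_ge0 a : 0 < lam a -> 0 <= ln a -> 0 <= T a.
  by move=> ? ?; rewrite mulr_ge0// divr_ge0// ?subr_ge0; exact: ltW.
have lamT a : 0 < lam a -> lam a * T a = (1 - c) * ln a.
  by move=> ?; rewrite /T; field; rewrite gt_eqF.
apply/cvgrPdist_le => e e_gt0.
(* Without data the minimal norm solution is [0], and the flow only rescales [thbar], where all
   outputs vanish. *)
have [n0|n_gt0] := posnP n.
  have noI (i : 'I_n) : False by case: i => m; rewrite n0.
  have h0 : hstar = 0.
    have /minh.2 : forall i, dotv (grad (fun th => f th (xs i)) thbar) 0 = ys i.
      by move=> i; have := noI i.
    rewrite ler_pM2r ?invr_gt0// /sqnorm raddf0 => H.
    apply/eqP; rewrite -normr_le0 (le_trans (normr_le_sqrt_sqnorm _))//.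
    by rewrite ler0_sqrtr.
  apply: filterS Hflow => a [lam_gt0 _ A_ge0 tr0 [ctr dtr]].
  rewrite h0 raddf0 sub0r normrN -/(T a).
  suff -> : traj a (T a) = expR (- (lam a * T a)) *: traj a 0.
    by rewrite hom tr0 hom f0 !mulr0 normr0 ltW.
  apply: weight_decay_flow.
  - exact: T_ge0.
  - by apply: continuous_subspaceW ctr => t /=; rewrite in_itv/= => /andP[].
  - by move=> t /dtr; rewrite big1 ?scaler0 ?add0r// => i; have := noI i.
have L_ge1 : 1 <= L.
  apply: (homogeneous_degree_ge1 (C1f (xs (Ordinal n_gt0))) (hom _) (th := thbar)).
  (* A vanishing gradient would be a zero row of a matrix with independent rows. *)
  apply/negP => /eqP g0.
  have : delta_mx 0 (Ordinal n_gt0) = 0 :> 'rV[R]_n.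
    by apply/eqP; rewrite -(mulmx_free_eq0 _ rf) -rowE rowK g0.
  by move=> /rowP/(_ (Ordinal n_gt0)); rewrite !mxE !eqxx => /eqP; rewrite oner_eq0.
have [K1 [K2 [K3 [d [K1_ge0 K2_ge0 K3_gt0 d_gt0 est]]]]] :=
  flow_prediction_estimate (fun i => C1f (xs i)) (C1f x) (fun i => hom (xs i)) (hom x)
    (fun i => f0 (xs i)) (f0 x) n_gt0 L_ge1 rf minh e_gt0.
have L_gt0 : 0 < L by rewrite (lt_le_trans ltr01).
(* Since [lam a <= c2] eventually, [T a] is at least [(1 - c) / c2 * ln a], so [K3 * T a] is at
   least [k3 * ln a]. *)
pose k3 := K3 * ((1 - c) / c2).
have k3_gt0 : 0 < k3 by rewrite mulr_gt0// divr_gt0// subr_gt0.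
apply: filter_app Hflow; near=> a => -[lam_gt0 lam_le A_ge0 tr0 [ctr dtr]].
rewrite distrC -/(T a).
apply: (est (ln a) (lam a) (T a)) => //.
- exact: T_ge0.
- by rewrite lamT//; nra.
- rewrite lamT//.
  (* Weight decay leaves the scale [expR (c * ln a)], which still diverges. *)
  have -> : L * (ln a - (1 - c) * ln a) = L * c * ln a by ring.
  by near: a; apply: near_pinfty_expR_ln_lt => //; rewrite mulr_gt0.
(* Half of [d] goes to [lam a], which vanishes by its upper power bound, and half to the exponential
   in [T a]. *)
- have B1 : K2 * c2 * expR (- (p * ln a)) < d / 2.
    by near: a; apply: near_pinfty_expR_ln_lt => //; rewrite divr_gt0.
  have B2 : K2 * expR (- (k3 * ln a)) < d / 2.
    by near: a; apply: near_pinfty_expR_ln_lt => //; rewrite divr_gt0.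
  have lam_le2 : lam a <= c2.
    rewrite (le_trans lam_le)// ler_piMr ?(ltW c20)// -expR0 ler_expR oppr_le0.
    by rewrite mulr_ge0// ltW.
  have B3 : expR (- (K3 * T a)) <= expR (- (k3 * ln a)).
    rewrite ler_expR lerN2 /k3 -mulrA ler_pM2l// /T ler_wpM2r//.
    by rewrite ler_pM2l ?subr_gt0// lef_pV2 ?posrE.
  have B4 := ler_wpM2l K2_ge0 B3.
  have := ler_wpM2l K2_ge0 lam_le; rewrite mulrA mulrDr => B5.
  lra.
Unshelve. all: by end_near. Qed.
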